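(* Let $(N,M)$ be a marked proper free-choice net having a home cluster. Then $(N,M)$ is lucent, i.e., for any reachable markings $M_1,M_2\in R(N,M)$, if $M_1$ and $M_2$ enable the same set of transitions then $M_1=M_2$.
   Context: A Petri net is a triple $N=(P,T,F)$ with $P$ (places) and $T$ (transitions) finite, non-empty, disjoint sets, and $F\subseteq (P\times T)\cup(T\times P)$ such that the graph $(P\cup T,F)$ is weakly connected. For a node $x$, ${}^\bullet x=\{y\mid (y,x)\in F\}$ and $x^\bullet=\{y\mid (x,y)\in F\}$. A marking $M$ is a multiset over $P$ (a function $P\to\mathbb{N}$); $(N,M)$ is a marked net. A transition $t$ is enabled in $M$ if $M(p)\ge 1$ for all $p\in {}^\bullet t$; $en(N,M)$ is the set of transitions enabled in $M$. Firing an enabled $t$ removes one token from each place of ${}^\bullet t$ and then adds one token to each place of $t^\bullet$. $R(N,M)$ is the set of markings obtainable from $M$ by firing finite (possibly empty) sequences of transitions. $(N,M)$ is lucent if for all $M_1,M_2\in R(N,M)$: $en(N,M_1)=en(N,M_2)$ implies $M_1=M_2$. $N$ is free-choice if for all $t_1,t_2\in T$: ${}^\bullet t_1={}^\bullet t_2$ or ${}^\bullet t_1\cap{}^\bullet t_2=\emptyset$. $N$ is proper if ${}^\bullet t\ne\emptyset$ and $t^\bullet\neq\emptyset$ for all $t\in T$. The cluster $[x]_c$ of a node $x\in P\cup T$ is the smallest set of nodes containing $x$ such that $p\in [x]_c\cap P$ implies $p^\bullet\subseteq [x]_c$, and $t\in[x]_c\cap T$ implies ${}^\bullet t\subseteq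 [x]_c$. For a cluster $C$, $Mrk(C)$ is the marking with exactly one token in each place of $C\cap P$ and no other tokens. A marking $M_H$ is a home marking of $(N,M)$ if $M_H\in R(N,M')$ for every $M'\in R(N,M)$. A cluster $C$ of $N$ is a home cluster of $(N,M)$ if $Mrk(C)$ is a home marking of $(N,M)$. *)

(* Defs.v *)
From mathcomp Require Import all_boot.
Set Implicit Arguments.
Unset Strict Implicit.
Unset Printing Implicit Defensive.

(* The bipartite graph (P, T, F).  P and T are separate types, hence disjoint;
   the flow relation F is given by its two parts, in P * T and in T * P. *)
Record net_graph := NetGraph {
  place : finType;
  trans : finType;
  arcPT : place -> trans -> bool;
  arcTP : trans -> place -> bool
}.

Definition node (N : net_graph) : finType := (place N + trans N)%type.

Definition arc (N : net_graph) : rel (node N) := fun x y =>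
  match x, y with
  | inl p, inr t => arcPT p t
  | inr t, inl p => arcTP t p
  | _, _ => false
  end.

Definition weakly_connected (N : net_graph) : Prop :=
  forall x y : node N, connect (fun u v => arc u v || arc v u) x y.

Record petri_net := PetriNet {
  graph_of :> net_graph;
  place_nonempty : 0 < #|place graph_of|;
  trans_nonempty : 0 < #|trans graph_of|;
  net_connected : weakly_connected graph_of
}.

Section Net.
Variable N : petri_net.

Definition preset (x : node N) : {set node N} := [set y | arc y x].
Definition postset (x : node N) : {set node N} := [set y | arc x y].

Definition marking := {ffun place N -> nat}.

Definition enabled (M : marking) (t : trans N) : bool :=
  [forall p : place N, (inl p \in preset (inr t)) ==> (1 <= M p)].

Definition en (M : marking) : {set trans N} := [set t | enabled M t].

(* The truncated subtraction is exact when t is enabled in M, and transitions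
   are only fired when enabled. *)
Definition fire (M : marking) (t : trans N) : marking :=
  [ffun p => M p - (inl p \in preset (inr t)) + (inl p \in postset (inr t))].

Fixpoint enabled_seq (M : marking) (s : seq (trans N)) : bool :=
  if s is t :: s' then enabled M t && enabled_seq (fire M t) s' else true.

Definition reachable (M M' : marking) : Prop :=
  exists2 s : seq (trans N), enabled_seq M s & M' = foldl fire M s.

Definition lucent (M : marking) : Prop :=
  forall M1 M2 : marking, reachable M M1 -> reachable M M2 ->
    en M1 = en M2 -> M1 = M2.

Definition free_choice : Prop :=
  forall t1 t2 : trans N,
    preset (inr t1) = preset (inr t2) \/
    preset (inr t1) :&: preset (inr t2) = set0.

Definition proper_net : Prop :=
  forall t : trans N, preset (inr t) <> set0 /\ postset (inr t) <> set0.

Definition cluster_closed (C : {set node N}) : bool :=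
  [forall p : place N, (inl p \in C) ==> (postset (inl p) \subset C)] &&
  [forall t : trans N, (inr t \in C) ==> (preset (inr t) \subset C)].

(* Closed sets are stable under intersection, so the intersection of all closed
   sets containing x is the smallest one. *)
Definition cluster (x : node N) : {set node N} :=
  \bigcap_(C : {set node N} | (x \in C) && cluster_closed C) C.

Definition is_cluster (C : {set node N}) : Prop := exists x, C = cluster x.

Definition Mrk (C : {set node N}) : marking := [ffun p => nat_of_bool (inl p \in C)].

Definition home_marking (M MH : marking) : Prop :=
  forall M' : marking, reachable M M' -> reachable M' MH.

Definition home_cluster (M : marking) (C : {set node N}) : Prop :=
  is_cluster C /\ home_marking M (Mrk C).

End Net.

(* Main.v *)
Require Import Defs.
From mathcomp Require Import all_boot zify.

(** Choices in a free-choice net are made cluster by cluster, so an enabled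
    cluster can fire at once whenever it fires later.  Since every run to the
    home marking must consume what an enabled cluster holds, this gives that two
    comparable reachable markings are equal.

    A "thread" is a path of places leading to the home cluster and meeting every
    cluster at most once.  Steering the tokens of a thread along it brings them
    all to the home cluster, where only one fits: a reachable marking has at most
    one token on a thread, and every marked place lies on a thread.

    Let M1 <> M2 be reachable and enable the same transitions.  Run M1 to the home
    marking until a cluster is full for which M1 - M2 provides a token, say at p;
    it was not full before, so it received a token at another place q.  The run
    does not use the surplus, hence it can be copied in M2, where q receives its
    token too.  That token can only leave through the cluster of p, so in M2 a
    token must reach p later, before any cluster on a thread T starting at p has
    fired.  Tracing this token back yields an extension of T to a place x of a
    cluster enabled in M2.  But this cluster is enabled in M1 as well, so M1 has
    two tokens, at x and at p, on one thread. *)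

Set Implicit Arguments.
Unset Strict Implicit.
Unset Printing Implicit Defensive.

Section PetriNet.
Variable N : petri_net.
Implicit Types (t u : trans N) (p q x y : place N) (X Y Z : marking N).
Implicit Types (s : seq (trans N)).

(** * Firing, sums of markings and framing of runs *)

Definition pre t : {set place N} := [set p | arcPT p t].
Definition post t : {set place N} := [set p | arcTP t p].

Lemma enabledP X t :
  reflect (forall p, p \in pre t -> 0 < X p) (enabled X t).
Proof.
apply: (iffP forallP) => h p; first by have := h p; rewrite !inE => /implyP.
by apply/implyP; rewrite inE => hp; apply: h; rewrite inE.
Qed.

Lemma unmarked X (D : {set place N}) :
  ~ (forall p, p \in D -> 0 < X p) -> exists2 q, q \in D & X q = 0.
Proof.
move=> nD; have [/exists_inP[q qD /eqP]|nq] :=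
  boolP [exists (q | q \in D), X q == 0]; first by exists q.
case: nD => q qD; rewrite lt0n; apply: contraNneq nq => Xq.
by apply/exists_inP; exists q; rewrite ?Xq.
Qed.

Lemma fireE X t p : fire X t p = X p - (p \in pre t) + (p \in post t).
Proof. by rewrite ffunE !inE. Qed.

Lemma enabled_seq_cat X s1 s2 :
  enabled_seq X (s1 ++ s2) =
  enabled_seq X s1 && enabled_seq (foldl (@fire N) X s1) s2.
Proof. by elim: s1 X => //= t s1 IH X; rewrite IH andbA. Qed.

Lemma reachable_cat X Y s :
  reachable X Y -> enabled_seq Y s -> reachable X (foldl (@fire N) Y s).
Proof.
by case=> s1 e1 -> e2; exists (s1 ++ s); rewrite ?enabled_seq_cat ?e1 ?foldl_cat.
Qed.

Lemma reachable_fire X Y t :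
  reachable X Y -> enabled Y t -> reachable X (fire Y t).
Proof. by move=> r e; apply: (@reachable_cat X Y [:: t]); rewrite //= e. Qed.

Definition touches (S : {set place N}) t := ~~ [disjoint pre t & S].


Lemma touchesP (S : {set place N}) t :
  reflect (exists2 p, p \in pre t & p \in S) (touches S t).
Proof.
rewrite /touches /disjoint; apply: (iffP pred0Pn) => [[p /andP[]] | [p]].
  by exists p.
by exists p; apply/andP.
Qed.

Lemma fire_mono X Y t p : X p <= Y p -> fire X t p <= fire Y t p.
Proof. by rewrite !fireE leq_add2r => /leq_sub2r. Qed.

Lemma foldl_untouched (S : {set place N}) X s p :
  p \in S -> ~~ has (touches S) s -> X p <= foldl (@fire N) X s p.
Proof.
move=> pS; elim: s X => //= t s IH X; rewrite negb_or => /andP[nt ns].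
apply: leq_trans (IH _ ns); rewrite fireE.
case: (boolP (p \in pre t)) => [pt|_]; last by rewrite subn0 leq_addr.
by case/touchesP: nt; exists p.
Qed.

Definition addm X Y : marking N := [ffun p => X p + Y p].

Lemma fire_addm X Y t : enabled X t -> fire (addm X Y) t = addm (fire X t) Y.
Proof.
move/enabledP=> e; apply/ffunP=> p; rewrite !(fireE, ffunE).
by case: (boolP (p \in pre t)) => [/e|_] /=; lia.
Qed.

Lemma run_addm X Y s : enabled_seq X s ->
  enabled_seq (addm X Y) s /\
  foldl (@fire N) (addm X Y) s = addm (foldl (@fire N) X s) Y.
Proof.
elim: s X => //= t s IH X /andP[e es].
have [es' E] := IH _ es; rewrite fire_addm // E es' andbT; split=> //.
by apply/enabledP=> p /(enabledP _ _ e); rewrite ffunE; lia.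
Qed.

(** All tokens of [Y] lie in [S], from which [s] takes nothing, so the tokens that [s] consumes
    never come from [Y]. *)
Lemma run_frame (S : {set place N}) X Y s :
    (forall p, p \notin S -> Y p = 0) -> ~~ has (touches S) s ->
  enabled_seq (addm X Y) s -> enabled_seq X s.
Proof.
move=> Y0; elim: s X => //= t s IH X; rewrite negb_or => /andP[nt ns] /andP[e].
have eX : enabled X t.
  apply/enabledP=> p pt; have /enabledP/(_ _ pt) := e; rewrite ffunE Y0 ?addn0 //.
  by apply: contra nt => pS; apply/touchesP; exists p.
by rewrite fire_addm // eX => /IH->.
Qed.

Lemma split_first (T : Type) (a : pred T) (s : seq T) : has a s ->
  exists (s1 : seq T) (t : T) (s2 : seq T),
    [/\ s = s1 ++ t :: s2, ~~ has a s1 & a t].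
Proof.
elim: s => //= t s IH; case: (boolP (a t)) => [at_ _|nat_ /= /IH].
  by exists [::], t, s.
by case=> s1 [u [s2 [-> h1 h2]]]; exists (t :: s1), u, s2; rewrite /= (negPf nat_).
Qed.

(** * Commutation in free-choice nets *)

Hypothesis pre_n0 : forall t, exists p, p \in pre t.
Hypothesis post_n0 : forall t, exists p, p \in post t.
Hypothesis fc : forall t u p, p \in pre t -> p \in pre u -> pre t = pre u.

Lemma touches_pre t u : touches (pre t) u -> pre u = pre t.
Proof. by case/touchesP=> p pu pt; apply: fc pu pt. Qed.

Lemma run_to_empty X s :
  enabled_seq X s -> (forall p, foldl (@fire N) X s p = 0) -> s = [::].
Proof.
case/lastP: s => // s t _; have [p pt] := post_n0 t.
by move/(_ p); rewrite foldl_rcons fireE pt; lia.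
Qed.

Lemma enabled_fire_disjoint X t u :
  pre t != pre u -> enabled X u -> enabled (fire X t) u.
Proof.
move=> d /enabledP e; apply/enabledP=> p pu; rewrite fireE.
case: (boolP (p \in pre t)) => [pt|_]; first by rewrite (fc pt pu) eqxx in d.
by have := e p pu; lia.
Qed.

Lemma fireC X t u : pre t != pre u -> enabled X t -> enabled X u ->
  fire (fire X t) u = fire (fire X u) t.
Proof.
move=> d /enabledP et /enabledP eu; apply/ffunP=> p; rewrite !fireE.
have := et p; have := eu p.
case: (boolP (p \in pre t)) => [pt|_]; case: (boolP (p \in pre u)) => [pu|_];
  first by rewrite (fc pt pu) eqxx in d.
all: lia.
Qed.

(** By free choice the presets in [s1] are disjoint from [pre t], so [t] stays enabled and commutes
    with each transition of [s1]. *)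
Lemma expedite X t s1 s2 :
    enabled X t -> ~~ has (touches (pre t)) s1 ->
    enabled_seq X (s1 ++ t :: s2) ->
  enabled_seq X (t :: s1 ++ s2) /\
  foldl (@fire N) X (s1 ++ t :: s2) = foldl (@fire N) X (t :: s1 ++ s2).
Proof.
elim: s1 X => //= u s1 IH X et; rewrite negb_or => /andP[nu n1] /andP[eu es].
have d : pre u != pre t.
  apply: contra nu => /eqP E; have [p pt] := pre_n0 t.
  by apply/touchesP; exists p; rewrite // E.
have [] := IH _ (enabled_fire_disjoint d et) n1 es.
rewrite /= et => /andP[_ h] ->.
by rewrite (fireC d) // -(fireC d) // h enabled_fire_disjoint // eq_sym.
Qed.

(** * The home cluster and comparable reachable markings *)

(* B stands for the places of the home cluster C, and unit_marking for Mrk C. *)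
Variables (B : {set place N}) (M0 : marking N).
Definition unit_marking : marking N := [ffun p => nat_of_bool (p \in B)].
(** The two shapes of a cluster: its transitions share one preset, which is its set of places, or it
    has no transition and is a single place. *)
Hypothesis B_block :
  (exists t, B = pre t) \/ (exists2 c, B = [set c] & forall t, c \notin pre t).
Hypothesis B_home : home_marking M0 unit_marking.
Local Notation R := (reachable M0).
Local Notation full X := (forall p, p \in B -> 0 < X p).

Lemma touches_home t : touches B t -> pre t = B.
Proof.
case: B_block => [[u ->]|[c -> hc]]; first exact: touches_pre.
by case/touchesP=> p pt /set1P E; rewrite E (negPf (hc t)) in pt.
Qed.

Lemma home_run X : R X ->
  exists2 s, enabled_seq X s & foldl (@fire N) X s = unit_marking.
Proof. by move/B_home => [s e ->]; exists s. Qed.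

(** Put aside one token of each place of [B]. The rest [U] still runs [s] and ends empty; as every
    transition produces a token, [s] is empty. *)
Lemma full_untouched X s : full X -> enabled_seq X s ->
  foldl (@fire N) X s = unit_marking -> ~~ has (touches B) s -> X = unit_marking.
Proof.
move=> f e E n; pose U : marking N := [ffun p => X p - (p \in B)].
have XE : X = addm U unit_marking.
  by apply/ffunP=> p; rewrite !ffunE; case: (boolP (p \in B)) => [/f|]; lia.
have eU : enabled_seq U s.
  apply: (@run_frame B _ unit_marking) => //; last by rewrite -XE.
  by move=> p; rewrite ffunE => /negPf->.
suff s0 : s = [::] by rewrite -E s0.
apply: (run_to_empty eU) => p; have [_] := run_addm unit_marking eU.
by rewrite -XE E => /ffunP/(_ p); rewrite !ffunE; lia.
Qed.

Lemma full_enabled X t : pre t = B -> full X -> enabled X t.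
Proof. by move=> E f; apply/enabledP; rewrite E. Qed.

(** Induction on the length of a run [s] from [Y] home. If the first transition of some cluster in
    [s] is enabled in [X], hence in [Y], it is moved to the front and fired in both markings: the
    order is kept, the run gets shorter, and the firing can be undone. *)
Lemma reachable_antichain X Y : R X -> R Y -> (forall p, X p <= Y p) -> X = Y.
Proof.
move=> rX rY le; have [s e E] := home_run rY.
have [n] := ubnP (size s); elim: n => // n IH in X Y s rX rY le e E *.
rewrite ltnS => sn.
have step s1 t s2 : s = s1 ++ t :: s2 -> ~~ has (touches (pre t)) s1 ->
    enabled X t -> X = Y.
  move=> sE n1 eX; have eY : enabled Y t.
    by apply/enabledP=> p /(enabledP _ _ eX)/leq_trans; apply.
  rewrite sE in e E; have [/= /andP[_ e'] E'] := expedite eY n1 e.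
  have FE : fire X t = fire Y t.
    apply: (IH _ _ (s1 ++ s2)) => //; try exact: reachable_fire.
    - by move=> p; apply: fire_mono.
    - by rewrite -E E'.
    - by rewrite sE !size_cat /= in sn *; lia.
  apply/ffunP=> p; move/ffunP/(_ p): FE; rewrite !fireE.
  case: (boolP (p \in pre t)) => [pt|_]; last by lia.
  by have := enabledP _ _ eX _ pt; have := enabledP _ _ eY _ pt; lia.
case: (boolP [forall (p | p \in B), 0 < X p]) => [/forall_inP fX|nf].
  have fY : full Y by move=> p /fX/leq_trans; apply.
  case: (boolP (has (touches B) s)) => [|h]; last first.
    have YE := full_untouched fY e E h.
    apply/ffunP=> p; apply/eqP; rewrite eqn_leq le /= YE ffunE.
    by case: (boolP (p \in B)) => // /fX.
  case/split_first=> s1 [t [s2 [sE n1 /touches_home tB]]].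
  by apply: step sE _ _; rewrite ?tB //; apply: full_enabled.
have [[|t s0] /= e0 E0] := home_run rX.
  by case/forall_inP: nf => p pB; rewrite E0 ffunE pB.
have /andP[et _] := e0.
(* If [s] avoided the cluster of [t], the tokens on [pre t] would survive into the home marking;
   then [pre t] is [B] and [X] would be full. *)
have : has (touches (pre t)) s.
  apply: contraNT nf => h; have [p pt] := pre_n0 t.
  have := foldl_untouched Y pt h; rewrite E ffunE => l.
  have pB : p \in B.
    have := enabledP _ _ et p pt; have := le p; case: (p \in B) l => //=; lia.
  have <- : pre t = B by apply: touches_home; apply/touchesP; exists p.
  by apply/forall_inP=> r; apply: (enabledP _ _ et).
case/split_first=> s1 [u [s2 [sE n1 /touches_pre uE]]].
apply: step sE _ _; first by rewrite uE.
by apply/enabledP; rewrite uE; apply: (enabledP _ _ et).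
Qed.

Lemma full_home X : R X -> full X -> X = unit_marking.
Proof.
move=> rX f; apply/esym/reachable_antichain => //.
  have [s e <-] := home_run rX; exact: reachable_cat.
by move=> p; rewrite ffunE; case: (boolP (p \in B)) => // /f.
Qed.

(** * Threads and their safety *)

(** The second disjunct adds something only when the home cluster is a single place without output
    transitions: it makes that place its own mate. *)
Definition mate p q :=
  [exists t, (p \in pre t) && (q \in pre t)] || (p \in B) && (q \in B).

Lemma mateP p q :
  reflect ((exists2 t, p \in pre t & q \in pre t) \/ p \in B /\ q \in B)
    (mate p q).
Proof.
apply: (iffP orP) => -[].
- by case/existsP=> t /andP[pt qt]; left; exists t.
- by case/andP; right.
- by case=> t pt qt; left; apply/existsP; exists t; rewrite pt.
- by case=> pB qB; right; rewrite pB.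
Qed.

Lemma mate_sym p q : mate p q = mate q p.
Proof.
by rewrite /mate andbC; congr (_ || _); apply: eq_existsb => t; rewrite andbC.
Qed.

Lemma pre_home t p : p \in pre t -> p \in B -> pre t = B.
Proof. by move=> pt pB; apply: touches_home; apply/touchesP; exists p. Qed.

Lemma mate_pre p q t : mate p q -> p \in pre t -> q \in pre t.
Proof.
case/mateP=> [[u pu qu] pt|[pB qB] pt]; first by rewrite (fc pt pu).
by rewrite (pre_home pt pB).
Qed.

Lemma mate_home p q : mate p q -> p \in B -> q \in B.
Proof. by case/mateP=> [[t pt qt] pB|[]//]; rewrite -(pre_home pt pB). Qed.

Lemma mate_trans q p r : mate p q -> mate q r -> mate p r.
Proof.
rewrite mate_sym => m /mateP[[t qt rt]|[qB rB]]; apply/mateP.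
  by left; exists t; rewrite ?(mate_pre m).
by right; rewrite (mate_home m).
Qed.

(* The rank decreases along the path; a thread is the set of its places. *)
Definition thread_rk (rk : place N -> nat) (S : {set place N}) :=
  (forall p q, p \in S -> q \in S -> mate p q -> p = q) /\
  (forall p, p \in S -> p \notin B ->
     exists t q, [/\ p \in pre t, q \in post t, q \in S & rk q < rk p]).

Definition thread S := exists rk, thread_rk rk S.

Lemma thread_cons (S : {set place N}) p : thread S ->
    (forall q, q \in S -> ~~ mate p q) ->
    p \in B \/ (exists t q, [/\ p \in pre t, q \in post t & q \in S]) ->
  thread (p |: S).
Proof.
case=> rk [hm hn] nm hp.
have mpp : mate p p.
  case: hp => [pB|[t [q [pt _ _]]]]; apply/mateP; first by right.
  by left; exists t.
have pS q : q \in S -> (q == p) = false.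
  by move/nm; apply: contraNF => /eqP->.
(* The new place heads the path, so its rank exceeds all ranks in [S]. *)
exists (fun q => if q == p then (\max_(r in S) rk r).+1 else rk q); split.
  move=> q r /setU1P[->|qS] /setU1P[->|rS] //; first by rewrite (negPf (nm _ rS)).
    by rewrite mate_sym (negPf (nm _ qS)).
  exact: hm.
move=> q /setU1P[->|qS] qB.
  case: hp => [pB|[t [r [pt rt rS]]]]; first by rewrite pB in qB.
  exists t, r; rewrite eqxx pS // in_setU1 rS orbT; split=> //.
  by rewrite ltnS leq_bigmax_cond.
have [t [r [qt rt rS lt]]] := hn q qS qB.
by exists t, r; rewrite !pS // in_setU1 rS orbT.
Qed.

(* Replaces the initial segment of a thread, up to p, by the single place q. *)
Lemma thread_swap rk (S : {set place N}) p q : thread_rk rk S -> p \in S ->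
  mate p q -> thread (q |: [set r in S | rk r < rk p]).
Proof.
move=> [hm hn] pS m; apply: thread_cons.
- exists rk; split=> [x y|x].
    by rewrite !inE => /andP[xS _] /andP[yS _]; apply: hm.
  rewrite inE => /andP[xS lx] xB; have [t [y [xt yt yS ly]]] := hn x xS xB.
  by exists t, y; split=> //; rewrite inE yS (ltn_trans ly).
- move=> r; rewrite inE => /andP[rS]; apply: contraTN => m'.
  by rewrite (hm p r pS rS (mate_trans m m')) ltnn.
case: (boolP (p \in B)) => [/(mate_home m)|pB]; first by left.
have [t [r [pt rt rS lr]]] := hn p pS pB.
by right; exists t, r; split=> //; [apply: mate_pre pt | rewrite inE rS].
Qed.

(** Induction on the run home. When its first transition consumes the token at [p], a thread through
    one of its output places is extended by [p]; if that thread already meets the cluster of [p], it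
    is cut there instead, with [p] as new head. *)
Lemma marked_thread X p : R X -> 0 < X p ->
  exists rk S, thread_rk rk S /\ p \in S.
Proof.
move=> rX; have [s e E] := home_run rX.
elim: s X p rX e E => [|t s IH] X p rX /=.
  move=> _ ->; rewrite ffunE lt0b => pB.
  have [|||rk h] := @thread_cons set0 p; last by exists rk, (p |: set0); rewrite setU11.
  - by exists (fun=> 0); split=> [x y|x]; rewrite inE.
  - by move=> q; rewrite inE.
  - by left.
case/andP=> et es E Xp; have rF := reachable_fire rX et.
case: (boolP (p \in pre t)) => pt; last first.
  by apply: (IH (fire X t)) => //; rewrite fireE (negPf pt); lia.
have [q qt] := post_n0 t.
have [|rk [S [hS qS]]] := IH (fire X t) q rF es E; first by rewrite fireE qt; lia.
case: (boolP [exists y in S, mate y p]) => [/exists_inP[y yS m]|nm].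
  have [rk' h] := thread_swap hS yS m.
  by exists rk', (p |: [set r in S | rk r < rk y]); rewrite setU11.
have [|||rk' h] := @thread_cons S p; last by exists rk', (p |: S); rewrite setU11.
- by exists rk.
- move=> y yS; apply: contraNN nm => m; apply/exists_inP; exists y => //.
  by rewrite mate_sym.
- by right; exists t, q.
Qed.

(** The inequality gives two tokens on the thread, also when [p = q]. The outer induction is on the
    sum of their ranks, the inner one on a run home, whose transitions are followed until one
    consumes one of the two tokens. *)
Lemma thread_safe S X : thread S -> R X ->
  forall p q, p \in S -> q \in S -> ~ (forall r, (r == p) + (r == q) <= X r).
Proof.
move=> [rk [hm hn]] rX p q pS qS; have [n] := ubnP (rk p + rk q).
elim: n => // n IHn in X rX p q pS qS *; rewrite ltnS => le_n.
have [s e E] := home_run rX.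
have at_home p' q' : p' \in S -> q' \in S ->
    ~ (forall r, (r == p') + (r == q') <= unit_marking r).
  move=> pS' qS' two; have mk r : 0 < unit_marking r -> r \in B by rewrite ffunE lt0b.
  have pB : p' \in B by apply: mk; have := two p'; rewrite eqxx; lia.
  have qB : q' \in B by apply: mk; have := two q'; rewrite eqxx; lia.
  have pq : p' = q' by apply: hm => //; apply/mateP; right.
  by have := two p'; rewrite -pq eqxx ffunE; case: (_ \in B).
elim: s X rX e E => [|t s IHs] X rX /=; first by move=> _ ->; apply: at_home.
case/andP=> et es E two; have rF := reachable_fire rX et.
case: (boolP [forall (r | r \in B), 0 < X r]) => [/forall_inP f|nf].
  by apply: (at_home p q) => //; rewrite -(full_home rX f).
(* The first transition to consume one of the two tokens is replaced by the one
   of its cluster that moves this token along the thread. *)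
have step p' q' : p' \in S -> q' \in S -> rk p' + rk q' <= n -> p' \in pre t ->
    ~ (forall r, (r == p') + (r == q') <= X r).
  move=> pS' qS' le' pt two'; have pB : p' \notin B.
    apply: contraNN nf => /(pre_home pt) <-.
    by apply/forall_inP=> r; apply: (enabledP _ _ et).
  have [u [r [pu ru rS lt]]] := hn p' pS' pB.
  have eu : enabled X u.
    by apply/enabledP; rewrite (fc pu pt); apply: (enabledP _ _ et).
  apply: (IHn _ (reachable_fire rX eu) r q' rS qS').
    by apply: leq_trans le'; rewrite ltn_add2r.
  move=> z; have := two' z; rewrite fireE.
  have rz : (z == r) <= (z \in post u).
    by case: (eqVneq z r) => [->|//]; rewrite ru.
  case: (boolP (z \in pre u)) => [zu|_] two_z; last by clear -rz two_z; lia.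
  (* If [u] also takes from [q'], then [q'] is a mate of [p'] on the thread, hence equal to it; two
     tokens lie there and one remains. *)
  have qz : (z == q') <= (z == p').
    case: (eqVneq z q') => [zq|//]; rewrite lt0b; apply/eqP.
    by apply: hm; rewrite ?zq //; apply/mateP; left; exists u; rewrite -?zq.
  have Xz : 0 < X z by apply: (enabledP _ _ eu).
  by clear -rz qz Xz two_z; lia.
case: (boolP (p \in pre t)) => pt; first exact: (step p q).
case: (boolP (q \in pre t)) => qt.
  by apply: (step q p) => //; [rewrite addnC | move=> r; rewrite addnC].
apply: (IHs _ rF es E) => r; have := two r; rewrite fireE.
case: (eqVneq r p) => [->|_]; first by rewrite (negPf pt); lia.
by case: (eqVneq r q) => [->|_]; first by rewrite (negPf qt); lia.
Qed.

Lemma thread_safe2 S X p q : thread S -> R X -> p \in S -> q \in S -> p != q ->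
  0 < X p -> 0 < X q -> False.
Proof.
move=> hS rX pS qS npq Xp Xq; apply: (thread_safe hS rX pS qS) => r.
case: (eqVneq r p) => [->|_]; first by rewrite (negPf npq) addn0.
by case: (eqVneq r q) => [->|_].
Qed.

Lemma safe X p : R X -> X p <= 1.
Proof.
move=> rX; rewrite leqNgt; apply/negP=> Xp.
have [|rk [S [hS pS]]] := marked_thread (p := p) rX; first by lia.
apply: (thread_safe (ex_intro _ rk hS) rX pS pS) => r.
by case: (eqVneq r p) => [->|_].
Qed.

(** * Tracing a token back, and lucency *)

(** Let [u] be the transition that marks [p]. If it is enabled in [X], any of its input places
    extends the thread. Otherwise it has an input place [q] unmarked in [X], and the search
    continues from [q] on the extended thread, with the run before [u]. *)
Lemma thread_backtrack X S s p : thread S -> p \in S -> X p = 0 ->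
    enabled_seq X s -> ~~ has (touches S) s -> 0 < foldl (@fire N) X s p ->
  exists S' q t, [/\ thread S', S \subset S', q \in S' :\: S, q \in pre t &
    enabled X t].
Proof.
have [n] := ubnP (size s).
elim: n => // n IH in S s p *; rewrite ltnS => sn hS pS Xp.
case/lastP: s sn => [|s u]; first by rewrite /= Xp.
rewrite size_rcons foldl_rcons has_rcons negb_or -cats1 enabled_seq_cat /= andbT.
set Y := foldl _ _ _ => sn /andP[es eu] /andP[nu ns].
case: (posnP (Y p)) => [Yp|Yp _]; last by apply: (IH S s p).
rewrite fireE Yp sub0n lt0b => pu.
(* If the cluster of u fires earlier, firing u itself there marks p sooner. *)
case: (boolP (has (touches (pre u)) s)) => [|ns'].
  case/split_first=> s1 [v [s2 [sE _ /touches_pre vE]]].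
  move: es ns; rewrite sE enabled_seq_cat has_cat negb_or /=.
  case/and3P=> e1 ev _ /andP[n1 _].
  have eu' : enabled (foldl (@fire N) X s1) u.
    by apply/enabledP; rewrite -vE; apply: (enabledP _ _ ev).
  apply: (IH S (rcons s1 u) p) => //.
  - by move: sn; rewrite sE size_cat size_rcons /=; lia.
  - by rewrite -cats1 enabled_seq_cat e1 /= eu'.
  - by rewrite has_rcons negb_or nu.
  - by rewrite foldl_rcons fireE pu; lia.
have cons q : q \in pre u -> thread (q |: S) /\ q \notin S.
  move=> qu; split; last by apply: contra nu => qS; apply/touchesP; exists q.
  apply: thread_cons => //; last by right; exists u, p.
  move=> r rS; apply: contra nu => m; apply/touchesP; exists r => //.
  exact: mate_pre qu.
case: (boolP (enabled X u)) => [eXu|].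
  have [q qu] := pre_n0 u; have [hq qS] := cons q qu.
  exists (q |: S), q, u; split; rewrite ?subsetUr //.
  by rewrite in_setD qS setU11.
move/enabledP/unmarked=> [q qu Xq].
have [hq qS] := cons q qu.
have [||S' [r [t [h1 h2 h3 h4 h5]]]] := IH (q |: S) s q sn hq (setU11 _ _) Xq es.
- apply/hasPn=> v vs; apply/touchesP=> -[r rv /setU1P[rq|rS]].
    apply: (negP ns'); apply/hasP; exists v => //; apply/touchesP; exists q => //.
    by rewrite -rq.
  by apply: (negP ns); apply/hasP; exists v => //; apply/touchesP; exists r.
- exact: (enabledP _ _ eu).
exists S', r, t; split=> //; first exact: subset_trans (subsetUr _ _) h2.
by move: h3; rewrite !inE negb_or => /andP[/andP[_ ->]].
Qed.

Lemma home_lucent : lucent M0.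
Proof.
move=> M1 M2 r1 r2 enE; apply/eqP; apply: contraT => /eqP ne; exfalso.
have enT t : enabled M1 t = enabled M2 t.
  by move/setP/(_ t): enE; rewrite !inE.
(* The common part and the two surpluses: a run of [M1] that takes nothing from [K1] is a run of
   [A], hence of [M2]. *)
pose A : marking N := [ffun p => minn (M1 p) (M2 p)].
pose K1 : marking N := [ffun p => M1 p - M2 p].
pose K2 : marking N := [ffun p => M2 p - M1 p].
have E1 : M1 = addm A K1 by apply/ffunP=> p; rewrite !ffunE; lia.
have E2 : M2 = addm A K2 by apply/ffunP=> p; rewrite !ffunE; lia.
pose K : {set place N} := [set p | 0 < K1 p].
have Knot p : p \notin K -> K1 p = 0 by rewrite inE; lia.
have [k kK] : exists k, k \in K.
  apply/existsP; apply: contraT; rewrite negb_exists => /forallP h.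
  case: ne; apply: reachable_antichain => // p.
  by have := Knot p (h p); rewrite ffunE; lia.
(* Otherwise [M1] is the home marking, and the first transition of a run from [M2] home, being
   enabled in [M1] too, has preset [B]; so [M2] is full as well. *)
have nfull1 : ~ full M1.
  move=> f1; have H1 := full_home r1 f1.
  have [s2 e2 F2] := home_run r2.
  case: s2 e2 F2 => [|t s2] /= e2 F2; first by case: ne; rewrite H1 F2.
  have /andP[et _] := e2.
  have tB : pre t = B.
    have [p pt] := pre_n0 t; apply: (@pre_home _ p) => //.
    by have := et; rewrite -enT => /enabledP/(_ p pt); rewrite H1 ffunE lt0b.
  case: ne; rewrite H1; apply/esym/full_home => //.
  by rewrite -tB; apply/enabledP.
have [s e E] := home_run r1.
(* [D] is the cluster that [s1] fills: that of the first transition to touch the surplus, or the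
   home cluster if there is none. *)
have [s1 [D [p [q [es1 ns1 fD [pD qD] [pK [Mq matD]]]]]]] :
    exists s1 (D : {set place N}) p q,
    [/\ enabled_seq M1 s1, ~~ has (touches K) s1,
        forall r, r \in D -> 0 < foldl (@fire N) M1 s1 r,
        p \in D /\ q \in D & p \in K /\ M1 q = 0 /\
        (forall r r', r \in D -> r' \in D -> mate r r')].
  case: (boolP (has (touches K) s)) => [|ns].
    case/split_first=> s1 [t [s2 [sE ns1 /touchesP[p pt pK]]]].
    move: e; rewrite sE enabled_seq_cat /= => /and3P[e1 et _].
    (* Were [t] enabled in [M1], it would be in [M2]; then both mark [p], and safety of [M1] leaves
       no surplus there. *)
    have [|q qt Mq] := @unmarked M1 (pre t).
      move/enabledP=> et1; have := et1; rewrite enT => /enabledP/(_ p pt).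
      by have := safe p r1; move: pK; rewrite inE ffunE; lia.
    exists s1, (pre t), p, q; split=> //; first exact: enabledP.
    by split=> //; split=> // r r' rt rt'; apply/mateP; left; exists t.
  have [q qB Mq] := unmarked nfull1.
  exists s, B, k, q; split=> //.
  - by move=> r rB; rewrite E ffunE rB.
  - split=> //; have := foldl_untouched M1 kK ns; rewrite E ffunE.
    by move: kK; rewrite inE ffunE; case: (k \in B) => //; lia.
  - by split=> //; split=> // r r' rB rB'; apply/mateP; right.
have M1p : 0 < M1 p by move: pK; rewrite inE ffunE; lia.
have M2p : M2 p = 0 by have := safe p r1; move: pK; rewrite inE ffunE; lia.
have mpq : mate p q := matD p q pD qD.
have eA : enabled_seq A s1.
  by apply: (run_frame Knot ns1); rewrite -E1.
have [_ F1] := run_addm K1 eA; have [e2 F2] := run_addm K2 eA.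
rewrite -E1 in F1; rewrite -E2 in e2 F2.
set Y2 := foldl (@fire N) M2 s1 in F2.
have rY2 : R Y2 by apply: reachable_cat.
have Yq : 0 < Y2 q.
  by move: (fD q qD); rewrite F1 F2 !ffunE Mq sub0n addn0; lia.
have [rk [S0 [hS0 pS0]]] := marked_thread r1 M1p.
pose T := [set r in S0 | rk r < rk p].
have mpp : mate p p := matD p p pD pD.
have Sp : thread (p |: T) := thread_swap hS0 pS0 mpp.
have Sq : thread (q |: T) := thread_swap hS0 pS0 mpq.
(* Run from [M1], [s1] keeps the surplus token at [p], so a transition touching the thread would
   find a second token on it. *)
have n1 : ~~ has (touches (p |: T)) s1.
  apply/negP=> /split_first[u [t [v [sE _ /touchesP[z zt zS]]]]].
  move: es1 ns1; rewrite sE enabled_seq_cat has_cat negb_or /=.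
  case/and3P=> eu et _ /andP[nu]; rewrite negb_or => /andP[nt _].
  have rY := reachable_cat r1 eu.
  apply: (thread_safe2 Sp rY (setU11 _ _) zS).
  - apply: contraNneq nt => pz; apply/touchesP; exists z => //.
    by rewrite -pz.
  - exact: leq_trans M1p (foldl_untouched M1 pK nu).
  - exact: (enabledP _ _ et).
(* Run home from [Y2] until the thread is touched. Until then [q] keeps its token, since only the
   cluster of [p] can take it. A touch in [T] would give two tokens on the thread headed by [q]; so
   the run ends with [p] marked. *)
have [s2 [es2 ns2 Yp]] : exists s2, [/\ enabled_seq Y2 s2,
    ~~ has (touches (p |: T)) s2 & 0 < foldl (@fire N) Y2 s2 p].
  have nq t : ~~ touches (p |: T) t -> ~~ touches [set q] t.
    apply: contraNN => /touchesP[z zt /set1P zq]; apply/touchesP; exists p.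
      by apply: (mate_pre (p := q)); rewrite 1?mate_sym // -zq.
    exact: setU11.
  have keep w : ~~ has (touches (p |: T)) w -> 0 < foldl (@fire N) Y2 w q.
    move=> nw; apply: leq_trans Yq (foldl_untouched _ (set11 q) _).
    by apply: contra nw; apply: sub_has => t; apply: contraTT; apply: nq.
  have [s2 e2' F2'] := home_run rY2.
  case: (boolP (has (touches (p |: T)) s2)) => [|ns2]; last first.
    exists s2; split=> //; rewrite F2' ffunE lt0b.
    by apply: (mate_home (p := q)); rewrite 1?mate_sym //;
       move: (keep _ ns2); rewrite F2' ffunE lt0b.
  case/split_first=> u [t [v [sE nu /touchesP[z zt zS]]]].
  move: e2'; rewrite sE enabled_seq_cat /= => /and3P[eu et _].
  exists u; split=> //; have /enabledP et' := et.
  case: (boolP (p \in pre t)) => [/et'//|pt]; exfalso.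
  have nz : z != p by apply: contraNneq pt => <-.
  have zT : z \in T by move: zS; rewrite in_setU1 (negPf nz).
  apply: (thread_safe2 Sq (reachable_cat rY2 eu) (setU11 _ _) _ _ _ (et' _ zt)).
  - by rewrite in_setU1 zT orbT.
  - apply: contraNneq pt => qz; apply: (mate_pre (p := q)).
      by rewrite mate_sym.
    by rewrite qz.
  - exact: keep.
have [|||S' [x [t [hS' sS xS xt et]]]] :=
    thread_backtrack (s := s1 ++ s2) Sp (setU11 _ _) M2p.
- by rewrite enabled_seq_cat e2.
- by rewrite has_cat negb_or n1.
- by rewrite foldl_cat.
move: xS; rewrite inE => /andP[xS xS'].
apply: (thread_safe2 hS' r1 (subsetP sS _ (setU11 _ _)) xS') => //.
  by apply: contraNneq xS => <-; rewrite setU11.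
by rewrite -enT in et; apply: (enabledP _ _ et).
Qed.

End PetriNet.

(** * The places of a cluster in a free-choice net *)

Section Clusters.
Variable N : petri_net.

Lemma mem_preset (t : trans N) p : (inl p \in preset (inr t)) = (p \in pre t).
Proof. by rewrite !inE. Qed.

Lemma cluster_closedP (C : {set node N}) :
  reflect ((forall p t, inl p \in C -> p \in pre t -> inr t \in C) /\
           (forall p t, inr t \in C -> p \in pre t -> inl p \in C))
    (cluster_closed C).
Proof.
apply: (iffP andP) => -[hp ht]; split.
- move=> p t pC pt; move/forall_inP/(_ p pC)/subsetP: hp; apply.
  by rewrite !inE in pt *.
- move=> p t tC pt; move/forall_inP/(_ t tC)/subsetP: ht; apply.
  by rewrite mem_preset.
- apply/forall_inP=> p pC; apply/subsetP=> -[q|t]; rewrite inE //= => pt.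
  by apply: hp pC _; rewrite inE.
apply/forall_inP=> t tC; apply/subsetP=> -[q|u]; rewrite inE //= => qt.
by apply: ht tC _; rewrite inE.
Qed.

Lemma mem_cluster (x : node N) : x \in cluster x.
Proof. by apply/bigcapP=> C /andP[]. Qed.

Lemma cluster_sub (x : node N) (C : {set node N}) :
  x \in C -> cluster_closed C -> cluster x \subset C.
Proof. by move=> xC cC; apply: bigcap_inf; rewrite xC. Qed.

Lemma closed_cluster (x : node N) : cluster_closed (cluster x).
Proof.
apply/cluster_closedP; split=> p t /bigcapP h pt; apply/bigcapP=> C hC.
  by have /andP[_ /cluster_closedP[hp _]] := hC; apply: hp (h _ hC) pt.
by have /andP[_ /cluster_closedP[_ ht]] := hC; apply: ht (h _ hC) pt.
Qed.

Hypothesis pre_n0 : forall t : trans N, exists p, p \in pre t.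
Hypothesis fc :
  forall (t u : trans N) p, p \in pre t -> p \in pre u -> pre t = pre u.

Lemma cluster_places (x : node N) p t :
  inl p \in cluster x -> p \in pre t -> [set q | inl q \in cluster x] = pre t.
Proof.
move=> pC pt; have /cluster_closedP[hp ht] := closed_cluster x.
(* [W] and its complement are both closed, so the cluster lies within one of them; it contains [p],
   which is in [W]. *)
pose W : {set node N} := [set y | match y with
  | inl q => q \in pre t | inr u => pre u == pre t end].
have WP q : (inl q \in W) = (q \in pre t) by rewrite inE.
have WT u : (inr u \in W) = (pre u == pre t) by rewrite inE.
have cW : cluster_closed W.
  apply/cluster_closedP; split=> q u; rewrite WP WT; first by move=> qt /fc/(_ qt)->.
  by move/eqP->.
have cW' : cluster_closed (~: W).
  apply/cluster_closedP; split=> q u; rewrite !in_setC WP WT.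
    by move=> + qu; apply: contra => /eqP<-.
  by move=> + qu; apply: contra => /(fc qu)->.
apply/setP=> q; rewrite inE; apply/idP/idP; last by apply: ht; apply: hp pC pt.
case: (boolP (x \in W)) => xW.
  by move/(subsetP (cluster_sub xW cW)); rewrite WP.
have xW' : x \in ~: W by rewrite in_setC.
by move/(subsetP (cluster_sub xW' cW')): pC; rewrite in_setC WP pt.
Qed.

Lemma cluster_block (x : node N) (B := [set p | inl p \in cluster x]) :
  (exists t, B = pre t) \/ (exists2 c, B = [set c] & forall t, c \notin pre t).
Proof.
have /cluster_closedP[_ ht] := closed_cluster x.
case: x @B ht (mem_cluster x) => [c|t] B ht xC; last first.
  have [p pt] := pre_n0 t; left; exists t.
  exact: cluster_places (ht _ _ xC pt) pt.
case: (boolP [exists t, c \in pre t]) => [/existsP[t ct]|].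
  by left; exists t; apply: cluster_places xC ct.
rewrite negb_exists => /forallP nc; right; exists c => //.
apply/setP=> p; rewrite !inE; apply/idP/eqP => [|->//].
have c1 : cluster_closed [set inl c : node N].
  apply/cluster_closedP; split=> q t; rewrite !in_set1 => /eqP// [->] ct.
  by rewrite (negPf (nc t)) in ct.
by move/(subsetP (cluster_sub (set11 _) c1)) => /set1P[].
Qed.

End Clusters.

Theorem corollary5p16 (N : petri_net) (M : marking N)
    (hproper : proper_net N) (hfc : free_choice N)
    (hhome : exists C : {set node N}, home_cluster M C) :
  lucent M.
Proof.
have pre_n0 (t : trans N) : exists p, p \in pre t.
  have [/eqP/set0Pn[[p|u]] + _] := hproper t; rewrite inE //= => pt.
  by exists p; rewrite inE.
have post_n0 (t : trans N) : exists p, p \in post t.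
  have [_ /eqP/set0Pn[[p|u]] +] := hproper t; rewrite inE //= => pt.
  by exists p; rewrite inE.
have fc (t u : trans N) p : p \in pre t -> p \in pre u -> pre t = pre u.
  move=> pt pu; case: (hfc t u) => [E|/setP/(_ (inl p))].
    by apply/setP=> q; rewrite -!mem_preset E.
  by rewrite in_setI !mem_preset pt pu in_set0.
have [_ [[x ->] hC]] := hhome.
apply: (home_lucent pre_n0 post_n0 fc (cluster_block pre_n0 fc x)).
suff -> : unit_marking [set p | inl p \in cluster x] = Mrk (cluster x) by [].
by apply/ffunP=> p; rewrite !ffunE inE.
Qed.
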